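(* Let $G$ be a graph and $\kappa$ an infinite cardinal. Then $L(\Omega_E(G))\leq\kappa$ if, and only if, for every finite $F\subseteq \mathrm{t}(G)$, $|\mathrm{C}(G,F)|\leq\kappa$.
   Context: A graph is a pair $G=(V(G),E(G))$ with $V(G)$ an arbitrary set and $E(G)\subseteq [V(G)]^2$ (two-element subsets). A ray in $G$ is an injective sequence of vertices $(v_0,v_1,\dots)$ with $\{v_i,v_{i+1}\}\in E(G)$ for all $i$; a tail of it is $(v_n,v_{n+1},\dots)$ for some $n$. For finite $F\subseteq E(G)$, $G\setminus F$ is the graph $(V(G),E(G)\setminus F)$; for finite $F\subseteq V(G)$, $G\setminus F$ is the subgraph induced on $V(G)\setminus F$. A connected component is a maximal connected subgraph. Two rays of $G$ are edge-equivalent if for every finite $F\subseteq E(G)$ they have tails lying in the same connected component of $G\setminus F$. An edge-end is an equivalence class of rays under edge-equivalence, and $\Omega_E(G)$ is the set of edge-ends. For an edge-end $\epsilon$ and finite $F\subseteq E(G)$, $G(\epsilon,F)$ is the unique connected component of $G\setminus F$ containing a tail of every ray of $\epsilon$, and $\Omega_E(\epsilon,F)$ is the set of all edge-ends having a ray contained in $G(\epsilon,F)$. A set $U\subseteq\Omega_E(G)$ is open if for every $\epsilon\in U$ there is a finite $F\subseteq E(G)$ with $\Omega_E(\epsilon,F)\subseteq U$; this topologizes $\Omega_E(G)$, the edge-end space of $G$. A vertex $v$ edge-dominates a ray $R$ if no finite set of edges separates them, i.e. for every finite $F\subseteq E(G)$ the connected component of $G\setminus F$ containing $v$ contains a tail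 of $R$. A vertex is timid if it edge-dominates no ray of $G$; $\mathrm{t}(G)$ is the set of timid vertices. For a finite set of vertices $F\subseteq V(G)$, $\mathrm{C}(G,F)$ is the set of connected components of $G\setminus F$ that contain a ray. The Lindelöf degree $L(X)$ of a space $X$ is the least infinite cardinal $\lambda$ such that every open cover of $X$ has a subcover of cardinality at most $\lambda$. *)

(* Defs.v *)
From HB Require Import structures.
From mathcomp Require Import all_boot.
From mathcomp Require Import boolp classical_sets functions cardinality filter.
From mathcomp Require Import topology.

Set Implicit Arguments.
Unset Strict Implicit.
Unset Printing Implicit Defensive.

Local Open Scope classical_set_scope.
Local Open Scope card_scope.

Definition pairs (T : Type) (A : set T) : set (set T) :=
  [set e | exists u v, [/\ A u, A v, u <> v & e = [set u; v]]].

Record graph (T : Type) := Graph {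
  vertices : set T;
  edges : set (set T);
  edges_pairs : edges `<=` pairs vertices
}.

Section Graphs.
Variable T : Type.
Implicit Types (G H C D : graph T) (u v w : T) (r s : nat -> T).

Lemma graph_eq G H : vertices G = vertices H -> edges G = edges H -> G = H.
Proof.
case: G H => [V E h] [V' E' h'] /= eV eE; subst V' E'.
by congr Graph; exact: Prop_irrelevance.
Qed.

Definition subgraph H G := vertices H `<=` vertices G /\ edges H `<=` edges G.

Fact remove_edges_pairs G (F : set (set T)) :
  edges G `\` F `<=` pairs (vertices G).
Proof. by move=> e [/edges_pairs]. Qed.

Definition remove_edges G (F : set (set T)) : graph T :=
  Graph (@remove_edges_pairs G F).

Fact induced_pairs G (A : set T) :
  [set e | edges G e /\ e `<=` A] `<=` pairs (vertices G `&` A).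
Proof.
move=> e [/edges_pairs[u [v [Gu Gv uv ->]]] sub].
by exists u, v; split=> //; split=> //; apply: sub; [left | right].
Qed.

Definition induced G (A : set T) : graph T := Graph (@induced_pairs G A).

Definition remove_vertices G (F : set T) : graph T := induced G (~` F).

Definition adjacent G : rel T := fun u v => `[< edges G [set u; v] >].

Definition joined G u v := exists2 p, path (adjacent G) u p & last u p = v.

Definition connected_graph G :=
  vertices G !=set0 /\
  forall u v, vertices G u -> vertices G v -> joined G u v.

Definition component G C :=
  [/\ subgraph C G, connected_graph C &
      forall D, subgraph D G -> connected_graph D -> subgraph C D -> D = C].

(* [is_ray C r] with [C] a subgraph says that the ray [r] is contained in [C],
   both with its vertices and with its edges. *)
Definition is_ray G r :=
  [/\ injective r, forall i, vertices G (r i) &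
      forall i, edges G [set r i; r i.+1]].

Definition tail n r : nat -> T := fun i => r (n + i).

Definition has_tail_in r C := exists n, is_ray C (tail n r).

Definition finite_edge_set G (F : set (set T)) :=
  finite_set F /\ F `<=` edges G.

Definition edge_equivalent G r s :=
  forall F, finite_edge_set G F ->
    exists C, [/\ component (remove_edges G F) C, has_tail_in r C
                & has_tail_in s C].

Record edge_end G := EdgeEnd {
  rays : set (nat -> T);
  raysP : exists2 r, is_ray G r &
    rays = [set s | is_ray G s /\ edge_equivalent G r s]
}.

(* [end_component epsilon F C] says that C is the component G(epsilon, F);
   see [end_component_exists] and [end_component_unique]. *)
Definition end_component G (epsilon : edge_end G) (F : set (set T)) C :=
  component (remove_edges G F) C /\
  forall r, rays epsilon r -> has_tail_in r C.

Definition basic_ends G (epsilon : edge_end G) (F : set (set T)) :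
    set (edge_end G) :=
  [set omega | exists C, end_component epsilon F C /\
                         exists2 r, rays omega r & is_ray C r].

Definition open_ends G (U : set (edge_end G)) :=
  forall epsilon, U epsilon ->
    exists2 F, finite_edge_set G F & basic_ends epsilon F `<=` U.

Definition edge_dominates G v r :=
  forall F, finite_edge_set G F ->
    exists C, [/\ component (remove_edges G F) C, vertices C v
                & has_tail_in r C].

Definition timid G : set T :=
  [set v | vertices G v /\ forall r, is_ray G r -> ~ edge_dominates G v r].

Definition ray_components G (F : set T) : set (graph T) :=
  [set C | component (remove_vertices G F) C /\ exists r, is_ray C r].

Lemma adjacent_sym G u v : adjacent G u v = adjacent G v u.
Proof. by rewrite /adjacent setUC. Qed.

Lemma joined_refl G v : joined G v v.
Proof. by exists [::]. Qed.

Lemma joined_trans G u v w : joined G u v -> joined G v w -> joined G u w.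
Proof.
move=> [p pp <-] [q qq <-]; exists (p ++ q); last by rewrite last_cat.
by rewrite cat_path pp.
Qed.

Lemma joined_edge G u v : edges G [set u; v] -> joined G u v.
Proof.
by move=> e; exists [:: v] => //=; rewrite andbT; apply/asboolP.
Qed.

Lemma joined_sym G u v : joined G u v -> joined G v u.
Proof.
move=> [p + <-]; elim: p u => [|x p IH] u /=; first by move=> _; exists [::].
move=> /andP[ux xp]; apply: joined_trans (IH _ xp) _.
by move: ux; rewrite adjacent_sym => /asboolP; exact: joined_edge.
Qed.

Lemma joined_sub G H u v : subgraph H G -> joined H u v -> joined G u v.
Proof.
move=> [_ sE] [p pp pv]; exists p => //.
by apply: sub_path pp => x y /asboolP xy; apply/asboolP/sE.
Qed.

Lemma subgraph_refl G : subgraph G G.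
Proof. by split. Qed.

Lemma subgraph_trans G H D : subgraph D H -> subgraph H G -> subgraph D G.
Proof. by move=> [a b] [c d]; split; [exact: subset_trans c|exact: subset_trans d]. Qed.

Lemma subgraph_anti G H : subgraph H G -> subgraph G H -> G = H.
Proof. by move=> [a b] [c d]; apply: graph_eq; apply/seteqP. Qed.

Lemma edge_vertices G u v :
  edges G [set u; v] -> vertices G u /\ vertices G v.
Proof.
move=> /edges_pairs[x [y [Gx Gy _ e]]].
have sub z : [set u; v] z -> vertices G z by rewrite e => -[] ->.
by split; apply: sub; [left | right].
Qed.

Lemma is_ray_sub G H r : subgraph H G -> is_ray H r -> is_ray G r.
Proof.
by move=> [sV sE] [ri rV rE]; split=> // i; [exact: sV | exact: sE].
Qed.

Lemma has_tail_in_sub G H r : subgraph H G -> has_tail_in r H -> has_tail_in r G.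
Proof. by move=> s [n nr]; exists n; exact: is_ray_sub nr. Qed.

Definition component_of G v : graph T := induced G (joined G v).

Lemma component_of_sub G v : subgraph (component_of G v) G.
Proof. by split=> [x [] | e []]. Qed.

Lemma component_of_joined G v w : joined G v w -> joined (component_of G v) v w.
Proof.
move=> [p pp <-]; exists p => //; elim/last_ind: p pp => [//|p x IH].
rewrite !rcons_path => /andP[pp px]; rewrite IH //=.
apply/asboolP; split; first exact/asboolP.
move=> y [] ->; first by exists p.
by exists (rcons p x); rewrite ?last_rcons // rcons_path pp.
Qed.

Lemma connected_sub_component_of G D v : subgraph D G -> connected_graph D ->
  vertices D v -> subgraph D (component_of G v).
Proof.
move=> sDG [_ Dc] Dv; have jD w : vertices D w -> joined G v w.
  by move=> Dw; apply: (joined_sub sDG); exact: Dc.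
split=> [w Dw | e De]; first by split; [exact: sDG.1 | exact: jD].
split; first exact: sDG.2.
by have [x [y [Dx Dy _ ->]]] := edges_pairs De; move=> z [] ->; exact: jD.
Qed.

Lemma component_ofP G v : vertices G v -> component G (component_of G v).
Proof.
move=> Gv; have Cv : vertices (component_of G v) v.
  by split=> //; exact: joined_refl.
split; first exact: component_of_sub.
- split; first by exists v.
  move=> u w [_ vu] [_ vw]; apply: (@joined_trans _ _ v).
    exact/joined_sym/component_of_joined.
  exact: component_of_joined.
- move=> D sDG Dc sCD; apply: subgraph_anti => //.
  by apply: connected_sub_component_of => //; exact: sCD.1.
Qed.

Lemma component_eq G C v : component G C -> vertices C v -> C = component_of G v.
Proof.
move=> [sC cC mC] Cv; have Gv := sC.1 _ Cv.
have [sO cO _] := component_ofP Gv.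
by apply/esym/mC => //; exact: connected_sub_component_of.
Qed.

Lemma component_inj G C D v : component G C -> component G D ->
  vertices C v -> vertices D v -> C = D.
Proof. by move=> hC hD Cv Dv; rewrite (component_eq hC Cv) (component_eq hD Dv). Qed.

Lemma connected_sub_component G D : subgraph D G -> connected_graph D ->
  exists2 C, component G C & subgraph D C.
Proof.
move=> sDG Dc; have [v Dv] := Dc.1; exists (component_of G v).
  by apply: component_ofP; exact: sDG.1.
exact: connected_sub_component_of.
Qed.

Lemma component_tail_inj G C D r : component G C -> component G D ->
  has_tail_in r C -> has_tail_in r D -> C = D.
Proof.
move=> hC hD [n [_ nC _]] [m [_ mD _]].
apply: (@component_inj G C D (r (n + m))) => //; first exact: nC.
by rewrite addnC; exact: mD.
Qed.

Lemma ray_component G r : is_ray G r ->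
  is_ray (component_of G (r 0)) r.
Proof.
move=> [ri rV rE]; have jr i : joined G (r 0) (r i).
  elim: i => [|i IH]; first exact: joined_refl.
  exact: joined_trans IH (joined_edge (rE i)).
by split=> // i; split=> //; move=> x [] ->; exact: jr.
Qed.

Lemma ray_edge_inj r : injective r ->
  injective (fun i => [set r i; r i.+1]).
Proof.
move=> ri i j e.
have h1 : [set r j; r j.+1] (r i) by rewrite -e; left.
have h2 : [set r j; r j.+1] (r i.+1) by rewrite -e; right.
by case: h1 => /ri // ij; case: h2 => /ri /eqP;
  rewrite ij ?eqSS ?gtn_eqF.
Qed.

Lemma ray_remove_edges G r (F : set (set T)) : is_ray G r -> finite_set F ->
  has_tail_in r (remove_edges G F).
Proof.
move=> [ri rV rE] Ff.
have fin : finite_set ((fun i => [set r i; r i.+1]) @^-1` F).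
  by apply: finite_preimage => // i j _ _; exact: ray_edge_inj.
have [n nP] : exists n, forall i, n <= i -> ~ F [set r i; r i.+1].
  have [s sE] := (finite_seqP _).1 fin.
  exists (\max_(k <- s) k).+1 => i ni Fi.
  have : i \in s.
    by have : [set` s] i by rewrite -sE.
  by move=> si; have := leq_trans ni (@leq_bigmax_seq _ s xpredT id i si isT); rewrite ltnn.
exists n; split=> [i j /ri/addnI // | i | i]; first exact: rV.
rewrite /tail addnS; split; first exact: rE.
by apply: nP; exact: leq_addr.
Qed.

Lemma ray_tail_component G r (F : set (set T)) : is_ray G r -> finite_set F ->
  exists2 C, component (remove_edges G F) C & has_tail_in r C.
Proof.
move=> hr Ff; have [n nr] := ray_remove_edges hr Ff.
exists (component_of (remove_edges G F) (tail n r 0)).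
  by apply: component_ofP; case: nr.
by exists n; exact: ray_component.
Qed.

Lemma edge_equivalent_refl G r : is_ray G r -> edge_equivalent G r r.
Proof. by move=> hr F [/(ray_tail_component hr)[C]]; exists C. Qed.

Lemma edge_equivalent_sym G r s : edge_equivalent G r s -> edge_equivalent G s r.
Proof. by move=> rs F /rs[C []]; exists C. Qed.

Lemma edge_equivalent_trans G r s t :
  edge_equivalent G r s -> edge_equivalent G s t -> edge_equivalent G r t.
Proof.
move=> rs st F hF; have [C [hC rC sC]] := rs _ hF.
have [D [hD sD tD]] := st _ hF; exists C; split=> //.
by rewrite (component_tail_inj hC hD sC sD).
Qed.

Lemma end_component_exists G (epsilon : edge_end G) F : finite_edge_set G F ->
  exists C, end_component epsilon F C.
Proof.
move=> hF; have [r hr eR] := raysP epsilon.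
have [C hC rC] := ray_tail_component hr hF.1; exists C; split=> // s.
rewrite eR => -[hs /(_ _ hF)[D [hD rD sD]]].
by rewrite (component_tail_inj hC hD rC rD).
Qed.

Lemma end_component_unique G (epsilon : edge_end G) F C D :
  end_component epsilon F C -> end_component epsilon F D -> C = D.
Proof.
move=> [hC rC] [hD rD]; have [r hr eR] := raysP epsilon.
have er : rays epsilon r by rewrite eR; split=> //; exact: edge_equivalent_refl.
by apply: component_tail_inj hC hD (rC _ er) (rD _ er).
Qed.

Lemma basic_ends_anti G (epsilon : edge_end G) F F' :
  F `<=` F' -> basic_ends epsilon F' `<=` basic_ends epsilon F.
Proof.
move=> sF omega [C [[[sC cC _] rC] [r wr Cr]]].
have sCG : subgraph C (remove_edges G F).
  by apply: subgraph_trans sC _; split=> // e [Ge nF]; split=> // /sF.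
have [D hD sCD] := connected_sub_component sCG cC.
exists D; split; last by exists r => //; exact: is_ray_sub Cr.
by split=> // s /rC; exact: has_tail_in_sub.
Qed.

HB.instance Definition _ G := gen_eqMixin (edge_end G).
HB.instance Definition _ G := gen_choiceMixin (edge_end G).

Lemma open_endsT G : open_ends [set: edge_end G].
Proof. by move=> epsilon _; exists set0 => //; split. Qed.

Lemma open_endsI G : setI_closed (@open_ends G).
Proof.
move=> U V oU oV epsilon [/oU[F [Ff FG] sU] /oV[F' [Ff' FG'] sV]].
exists (F `|` F').
  by split; [rewrite finite_setU | move=> e [/FG | /FG']].
move=> omega hw; split.
  by apply: sU; apply: basic_ends_anti hw; exact: subsetUl.
by apply: sV; apply: basic_ends_anti hw; exact: subsetUr.
Qed.

Lemma open_ends_bigU G (I : Type) (f : I -> set (edge_end G)) :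
  (forall i, open_ends (f i)) -> open_ends (\bigcup_i f i).
Proof.
move=> fo epsilon [i _ /fo[F hF sF]]; exists F => // omega /sF.
by exists i.
Qed.

HB.instance Definition _ G := isOpenTopological.Build (edge_end G)
  (@open_endsT G) (@open_endsI G) (@open_ends_bigU G).

Lemma open_endsE G (U : set (edge_end G)) : open U = open_ends U.
Proof. by []. Qed.

End Graphs.

(* A cardinal is represented by any set having this cardinality. *)
Definition subcovers_le (X : topologicalType) (L : Type) (lambda : set L) :=
  forall U : set (set X), U `<=` open -> cover U id = setT ->
    exists V : set (set X), [/\ V `<=` U, cover V id = setT & V #<= lambda].

Definition lindelof_degree (X : topologicalType) (L : Type) (lambda : set L) :=
  [/\ infinite_set lambda, subcovers_le X lambda &
      forall (M : Type) (mu : set M),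
        infinite_set mu -> subcovers_le X mu -> lambda #<= mu].

Definition lindelof_degree_le (X : topologicalType) (K : Type) (kappa : set K) :=
  exists (L : Type) (lambda : set L),
    lindelof_degree X lambda /\ lambda #<= kappa.

(* Main.v *)
Require Import Defs.
From mathcomp Require Import all_boot finmap.
From mathcomp Require Import boolp classical_sets functions cardinality filter.
From mathcomp Require Import topology.

Local Open Scope classical_set_scope.
Local Open Scope card_scope.

(** Since cardinals are well-ordered, the bound on the Lindelof degree says that
    every open cover has a subcover of size at most [kappa]
    ([lindelof_degree_leP]).

    Suppose this holds, and let [F] be a finite set of timid vertices.  Every
    edge-end is separated from [F] by finitely many edges
    ([timid_separated]), so it has a basic neighbourhood whose component avoids
    [F] and hence lies in one component of [G - F].  A subcover of these
    neighbourhoods reaches every component of [G - F] that contains a ray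
    ([ray_components_le]).

    Conversely, fix an open cover, and call a vertex set covered if at most
    [kappa] members of the cover contain all the ends with a ray in that set; as
    [kappa * kappa = kappa], a set is covered once its ends all have rays in
    members of a family of at most [kappa] covered sets ([covered_bigcup]).
    Suppose that the whole graph is uncovered.  One builds a decreasing sequence
    of connected uncovered sets [C n], where [C n] is joined by finitely many
    edges to the rest of [G - V n], for some finite set [V n] of timid vertices,
    together with a vertex [v n] of [C n].  If some uncovered part of [C n] can
    be cut off from [v n] by finitely many edges, then [C n.+1] is such a part,
    chosen with as few edges to the rest of [G - V n] as possible, and
    [V n.+1 = V n].  Otherwise [v n] is timid ([no_candidate_timid]): if it
    edge-dominated a ray, deleting the finitely many edges around a covered
    neighbourhood of its end would cut off an uncovered part.  Then [v n] is
    added to [V n], and [C n.+1] is an uncovered component of [C n - v n]; it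
    exists because deleting a finite set of timid vertices leaves at most
    [kappa] components with rays ([uncovered_connected]).  Paths from [v n] to
    [v n.+1] inside [C n] meet [C n.+1] only at their end, so they concatenate
    to a ray ([concatenated_ray]).

    The end of this ray has a neighbourhood with a covered component, with
    vertex set [A], cut out by a finite set [F] of edges ([covered_nbhs]).  For
    large [n], [v n] lies in [A], and [C n \ A] is an uncovered part of [C n]
    cut off from [v n]; so only the first kind of step occurs and [V n] is
    constant.  By submodularity of the size of edge cuts, the minimal choice of
    [C n.+1] forces [C n.+1 \ A] to have no larger a cut than [C n \ A]; hence
    the cuts of the sets [C n] have bounded size.  Some edge of [F] lies in all
    the [C n], so their intersection is nonempty.  But connected sets with
    bounded cuts that decrease to a nonempty intersection must be eventually
    constant, whereas [v n] lies in [C n] and not in [C n.+1]: this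
    contradiction is [sequence_absurd]. *)

(** * Cardinals and finite sets *)

(** Injections are replaced by left-unique total relations: these can be
    defined without choosing values, in particular outside [A]. *)
Lemma card_le_relP {T U} {A : set T} {B : set U} :
  A #<= B <-> exists R : T -> U -> Prop,
    (forall a, A a -> exists2 b, B b & R a b) /\
    (forall a a' b, A a -> A a' -> R a b -> R a' b -> a = a').
Proof.
split=> [/card_leP[f] | [R [tot inj]]].
  exists (fun a b => exists Aa : a \in A, val (f (SigSub Aa)) = b); split.
    move=> a Aa; exists (val (f (SigSub (mem_set Aa)))); first exact: set_valP.
    by exists (mem_set Aa).
  move=> a a' b _ _ [Aa <-] [Aa' /val_inj e].
  have : SigSub Aa' = SigSub Aa by apply: 'inj_f e; rewrite inE.
  by move=> [].
have /choice[f fP] : forall a : A, exists b : B, R (val a) (val b).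
  move=> a; have [b Bb Rab] := tot (val a) (set_valP a).
  by exists (SigSub (mem_set Bb)).
apply/card_leP/injfunPex; exists f => // x y _ _ e.
by apply/val_inj/(inj _ _ _ (set_valP x) (set_valP y) (fP x)); rewrite e.
Qed.

Lemma card_leX {T U T' U'} (A : set T) (B : set U) (A' : set T') (B' : set U') :
  A #<= A' -> B #<= B' -> A `*` B #<= A' `*` B'.
Proof.
move=> /card_le_relP[R [tR iR]] /card_le_relP[S [tS iS]]; apply/card_le_relP.
exists (fun p q => R p.1 q.1 /\ S p.2 q.2); split.
  move=> [a b] [/= /tR[a' Aa' ra] /tS[b' Bb' sb]]; by exists (a', b').
move=> [a b] [a1 b1] [a' b'] [/= Aa Bb] [/= Aa1 Bb1] [/= r s] [/= r1 s1].
by rewrite (iR _ _ _ Aa Aa1 r r1) (iS _ _ _ Bb Bb1 s s1).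
Qed.

(** The union is coded inside [Y * Y], a first coordinate [y0] or [y1]
    recording the set that an element comes from. *)
Lemma card_leU {T U} (A B : set T) (Y : set U) :
  infinite_set Y -> Y `*` Y #<= Y -> A #<= Y -> B #<= Y -> A `|` B #<= Y.
Proof.
move=> Yinf YY /card_le_relP[R [tR iR]] /card_le_relP[S [tS iS]].
have [y0 Yy0] := infinite_setN0 Yinf.
have [y1 [Yy1 ny1]] : exists y1, Y y1 /\ y1 <> y0.
  apply: contrapT => /forallNP ny; apply: Yinf.
  apply: (@sub_finite_set _ _ [set y0]); last exact: finite_set1.
  by move=> y Yy; apply: contrapT => yy; apply: (ny y).
apply: card_le_trans YY; apply/card_le_relP.
exists (fun p q => if `[< A p >] then q.1 = y0 /\ R p q.2
                   else q.1 = y1 /\ S p q.2); split.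
  move=> p ABp; case: asboolP => Ap.
    by have [b Yb Rb] := tR _ Ap; exists (y0, b).
  have Bp : B p by case: ABp.
  by have [b Yb Rb] := tS _ Bp; exists (y1, b).
move=> p p' [q1 q2] ABp ABp'; case: asboolP => Ap; case: asboolP => Ap' /=.
- by move=> [_ r] [_ r']; exact: iR r r'.
- by move=> [-> _] [/esym].
- by move=> [-> _] [].
- move=> [_ r] [_ r']; apply: iS r r'; [by case: ABp | by case: ABp'].
Qed.

(** Well-ordering of cardinals, after Honig.  Consider the sets [S] of choice
    functions such that every projection is injective on [S].  For a maximal one
    some projection is onto, since otherwise the values missed by the
    projections would form a new choice function; composing its inverse with
    the other projections injects [A i] in every [A j]. *)
Lemma least_card (I : Type) (i0 : I) (U : I -> Type) (A : forall i, set (U i)) :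
  exists i, forall j, A i #<= A j.
Proof.
pose P (S : set (forall i, U i)) :=
  (forall x i, S x -> A i (x i)) /\
  (forall x y i, S x -> S y -> x i = y i -> x = y).
have [F FP Ftot|S [[SA Sinj] Smax]] := @Zorn_bigcup _ P.
  split=> [x i [X FX Xx] | x y i [X FX Xx] [Y FY Yy] xy].
    by have [+ _] := FP _ FX; apply.
  by have [XY|YX] := Ftot _ _ FX FY;
    [have [_] := FP _ FY | have [_] := FP _ FX]; apply; eauto.
have [i iP] : exists i, forall a, A i a -> exists2 x, S x & x i = a.
  apply: contrapT => /forallNP nS.
  have /all_sig[z zP] i : {a | A i a /\ forall x, S x -> x i <> a}.
    apply: cid; have /existsNP[a /not_implyP[Aa na]] := nS i; exists a; split=> //.
    by move=> x Sx xa; apply: na; exists x.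
  apply: (Smax (z |` S)); first split; first exact: subsetUr.
    by move=> /(_ z (or_introl erefl)) Sz; have [_ /(_ z Sz)] := zP i0.
  split=> [x i [->|/SA//] | x y i [->|Sx] [->|Sy] //]; first by case: (zP i).
  - by move=> /esym; have [_ /(_ _ Sy)] := zP i.
  - by have [_ /(_ _ Sx)] := zP i.
  - exact: Sinj.
exists i => j; apply/card_le_relP.
exists (fun a b => exists2 x, S x & x i = a /\ x j = b); split.
  by move=> a /iP[x Sx xa]; exists (x j); [exact: SA | exists x].
by move=> a a' b _ _ [x Sx [<- xb]] [y Sy [<-]]; rewrite -xb => /esym/(Sinj _ _ _ Sx Sy) ->.
Qed.

Lemma card_le_total {T U : Type} (A : set T) (B : set U) : A #<= B \/ B #<= A.
Proof.
pose S (b : bool) : Type := if b then T else U.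
pose C b : set (S b) := if b return set (S b) then A else B.
have [[] /= least] := @least_card bool true S C.
  by left; exact: (least false).
by right; exact: (least true).
Qed.

(** Take a maximal subset [D S] of [A] with an injection [S] of its square into
    itself, coded by its graph.  If [A \ D S] contained an infinite [Y] at least
    as large as [D S] whose square injects into [Y], then the pairs of elements
    of [D S `|` Y] that are not pairs of [D S] could be sent into [Y], and [S]
    would extend ([noext]).  So [A] is no larger than [D S]. *)
Lemma infinite_card_square {T} (A : set T) : infinite_set A -> A `*` A #<= A.
Proof.
move=> Ainf; pose D (S : set ((T * T) * T)) := [set x | exists z, S ((x, x), z)].
pose P S := [/\ forall x y z, S ((x, y), z) -> [/\ D S x, D S y & D S z],
  D S `<=` A, forall x y, D S x -> D S y -> exists z, S ((x, y), z) &
  forall p q z, S (p, z) -> S (q, z) -> p = q].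
have sD S S' : S `<=` S' -> D S `<=` D S' by move=> sS x [z /sS]; exists z.
have [F FP Ftot|S [[Sfield SA Stot Sinj] Smax]] := @Zorn_bigcup _ P.
  split.
  - move=> x y z [X FX]; have [+ _ _ _] := FP _ FX => /[apply].
    have sX := sD _ _ (bigcup_sup (F := id) FX).
    by move=> [/sX ? /sX ? /sX].
  - by move=> x [z [X FX Xz]]; have [_ + _ _] := FP _ FX; apply; exists z.
  - move=> x y [z [X FX Xz]] [t [Y FY Yt]].
    have [XY|YX] := Ftot _ _ FX FY.
      have [_ _ + _] := FP _ FY => /(_ x y)[||u]; first by exists z; exact: XY.
        by exists t.
      by exists u, Y.
    have [_ _ + _] := FP _ FX => /(_ x y)[||u]; first by exists z.
      by exists t; exact: YX.
    by exists u, X.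
  - move=> p q z [X FX Xp] [Y FY Yq].
    by have [XY|YX] := Ftot _ _ FX FY;
      [have [_ _ _] := FP _ FY | have [_ _ _] := FP _ FX]; apply; eauto.
have DD : D S `*` D S #<= D S.
  apply/card_le_relP; exists (fun p z => S (p, z)); split.
    move=> [x y] [/= Dx Dy]; have [z Sz] := Stot _ _ Dx Dy.
    by exists z => //; have [_ _] := Sfield _ _ _ Sz.
  by move=> p q z _ _; exact: Sinj.
have noext Y : Y `<=` A `\` D S -> infinite_set Y -> Y `*` Y #<= Y ->
    D S #<= Y -> False.
  move=> YA Yinf YY DY.
  have E : D S `|` Y #<= Y by exact: card_leU.
  have /card_le_relP[R [tR iR]] := card_le_trans (card_leX _ _ _ _ E E) YY.
  pose N := [set t : (T * T) * T | [/\ (D S `|` Y) t.1.1, (D S `|` Y) t.1.2,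
     ~ (D S t.1.1 /\ D S t.1.2), Y t.2 & R t.1 t.2]].
  have DN : D (S `|` N) = D S `|` Y.
    apply/seteqP; split=> x.
      by move=> [z [Sz|[]//]]; left; exists z.
    move=> EX; have [Dx|nDx] := pselect (D S x); first exact: (sD _ _ (@subsetUl _ _ _)).
    have [z Yz Rz] := tR (x, x) (conj EX EX).
    by exists z; right; split=> //; case.
  have SY x y z : S (x, y, z) -> ~ Y z.
    by move=> Sz Yz; have [_ _ Dz] := Sfield _ _ _ Sz; have [] := YA _ Yz.
  apply: (Smax (S `|` N)); first split; first exact: subsetUl.
    move=> NS; have [y Yy] := infinite_setN0 Yinf; have [_ nDy] := YA _ Yy.
    have [z Yz Rz] := tR (y, y) (conj (or_intror Yy) (or_intror Yy)).
    have : N (y, y, z) by split=> //; [right|right|case].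
    by move=> Nz; apply: nDy; exists z; apply: NS; right.
  rewrite /P DN; split.
  - move=> x y z [/Sfield[Dx Dy Dz] | [/= Ex Ey _ Yz _]]; first by split; left.
    by split=> //; right.
  - by rewrite subUset; split=> // y /YA[].
  - move=> x y Ex Ey; have [[Dx Dy]|nD] := pselect (D S x /\ D S y).
      by have [z Sz] := Stot _ _ Dx Dy; exists z; left.
    have [z Yz Rz] := tR (x, y) (conj Ex Ey).
    by exists z; right.
  - move=> [x y] [x' y'] z [Sp|[/= Ex Ey _ Yz Rp]] [Sq|[/= Ex' Ey' _ Yz' Rq]].
    + exact: Sinj Sp Sq.
    + by have := SY _ _ _ Sp Yz'.
    + by have := SY _ _ _ Sq Yz.
    + exact: iR Rp Rq.
(* A finite [D S] leaves room for a countable [Y]. *)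
have [Dfin|Dinf] := pselect (finite_set (D S)).
  have AD : infinite_set (A `\` D S) by exact: infinite_setD.
  have [Y Ynat YAD] := elimT (card_subP _ _) (proj1 (infiniteP _) AD).
  have Yinf : infinite_set Y.
    by apply/infiniteP; rewrite (card_le_eqr Ynat).
  exfalso; apply: (noext Y) => //.
    rewrite (card_le_eqr Ynat).
    have YN : Y #<= [set: nat] by rewrite (card_le_eql Ynat).
    apply: card_le_trans (card_leX _ _ _ _ YN YN) _.
    by rewrite setXTT (card_le_eql card_nat2).
  by rewrite (card_le_eqr Ynat); exact: finite_set_countable.
have [AD|/card_subP[Y YD YAD]] := card_le_total (A `\` D S) (D S).
  have AleD : A #<= D S.
    have -> : A = (A `\` D S) `|` D S by rewrite setUC setDUK.
    exact: card_leU.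
  apply: card_le_trans (card_leX _ _ _ _ AleD AleD) _.
  by apply: card_le_trans DD _; exact: subset_card_le.
exfalso; apply: (noext Y) => //.
- by apply/infiniteP; rewrite (card_le_eqr YD); apply/infiniteP.
- rewrite (card_le_eqr YD).
  have YD' : Y #<= D S by rewrite (card_le_eql YD).
  exact: card_le_trans (card_leX _ _ _ _ YD' YD') DD.
- by rewrite (card_le_eqr YD).
Qed.

Lemma card_bigcup_le {I T K} (J : set I) (W : I -> set T) (kappa : set K) :
  infinite_set kappa -> J #<= kappa -> (forall j, J j -> W j #<= kappa) ->
  \bigcup_(j in J) W j #<= kappa.
Proof.
move=> kinf /card_le_relP[R [tR iR]] Wk.
apply: card_le_trans (infinite_card_square _ kinf).
have /choice[S SP] : forall j, exists S : T -> K -> Prop, J j ->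
    (forall a, W j a -> exists2 b, kappa b & S a b) /\
    (forall a a' b, W j a -> W j a' -> S a b -> S a' b -> a = a').
  move=> j; have [/Wk/card_le_relP[S SP]|nJ] := pselect (J j); first by exists S.
  by exists (fun _ _ => True).
apply/card_le_relP.
exists (fun w q => exists2 j, J j /\ W j w & R j q.1 /\ S j w q.2); split.
  move=> w [j Jj Ww]; have [a ka ra] := tR _ Jj.
  by have [b kb sb] := (SP _ Jj).1 _ Ww; exists (a, b) => //; exists j.
move=> w w' [a b] _ _ [j [Jj Ww] [/= Rj Sj]] [j' [Jj' Ww'] [/= Rj' Sj']].
move: (iR _ _ _ Jj Jj' Rj Rj') => e; rewrite -e in Ww' Sj'.
exact: (SP _ Jj).2 Ww Ww' Sj Sj'.
Qed.

Lemma finite_card_le {T K} (A : set T) (kappa : set K) :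
  infinite_set kappa -> finite_set A -> A #<= kappa.
Proof.
move=> /infiniteP kinf /finite_set_countable Afin; exact: card_le_trans Afin kinf.
Qed.

Lemma finite_eventually {E} (A : set E) (P : E -> nat -> Prop) :
  finite_set A -> (forall e, A e -> exists n, forall m, n <= m -> P e m) ->
  exists n, forall e, A e -> forall m, n <= m -> P e m.
Proof.
move=> Afin AP.
have /choice[f fP] : forall e, exists n, A e -> forall m, n <= m -> P e m.
  by move=> e; have [/AP[n]|] := pselect (A e); [exists n | exists 0].
have [s sE] := (finite_seqP _).1 (finite_image f Afin).
exists (\max_(k <- s) k) => e Ae m sm; apply: fP => //; apply: leq_trans sm.
apply: (@leq_bigmax_seq _ s xpredT id) => //.
by have : [set` s] (f e) by rewrite -sE; exists e.
Qed.

Lemma subcovers_le_card {X : topologicalType} {L M : Type} (lambda : set L)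
    (mu : set M) :
  lambda #<= mu -> subcovers_le X lambda -> subcovers_le X mu.
Proof.
move=> lm sl U Uopen Ucov; have [V [VU Vcov Vl]] := sl U Uopen Ucov.
by exists V; split=> //; exact: card_le_trans Vl lm.
Qed.

(** The degree is the least infinite subset of [kappa] that bounds subcovers;
    it is compared with a cardinal [mu] on another type by replacing [mu], if
    it is smaller than that subset, by one of its copies inside [kappa]. *)
Lemma lindelof_degree_leP {X : topologicalType} {K : Type} (kappa : set K) :
  infinite_set kappa -> lindelof_degree_le X kappa <-> subcovers_le X kappa.
Proof.
move=> kinf; split=> [[L [lambda [[_ sl _] lk]]] | sk].
  exact: subcovers_le_card lk sl.
pose I := {A : set K | infinite_set A /\ subcovers_le X A}.
have [[A [Ainf sA]] least] :=
  @least_card I (exist _ kappa (conj kinf sk)) (fun=> K) sval.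
exists K, A; split; last exact: least (exist _ kappa (conj kinf sk)).
split=> // M mu muinf smu.
have [//|muA] := card_le_total A mu.
have [B Bmu BA] := elimT (card_subP _ _) muA.
have muB : mu #<= B by rewrite (card_le_eqr Bmu).
have Binf : infinite_set B by move=> /(card_le_finite muB).
have sB := subcovers_le_card _ _ muB smu.
by rewrite -(card_le_eqr Bmu); exact: least (exist _ B (conj Binf sB)).
Qed.

(** * Rays and basic neighbourhoods of ends *)

Section GraphFacts.
Context {T : Type}.
Implicit Types (G H C D : graph T) (r s : nat -> T) (X Y V : set T).

(** The first edge of a path that leaves [X]: up to it the path stays in [X]. *)
Lemma crossing_edge {H X u w} : joined H u w -> X u -> ~ X w ->
  exists a b, [/\ X a, ~ X b, edges H [set a; b] & joined (induced H X) u a].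
Proof.
move=> [p + <-]; elim: p u => [|x p IH] u /=; first by [].
move=> /andP[/asboolP ux xp] Xu nXw.
have [Xx|nXx] := pselect (X x); last first.
  by exists u, x; split=> //; exact: joined_refl.
have [a [b [Xa nXb ab xa]]] := IH _ xp Xx nXw.
exists a, b; split=> //; apply: joined_trans xa; apply: joined_edge.
by split=> // y [] ->.
Qed.

Lemma component_edge_closed {H D a b} : component H D -> vertices D a ->
  edges H [set a; b] -> vertices D b.
Proof.
move=> hD Da ab; rewrite (component_eq hD Da); split.
  by have [] := edge_vertices ab.
exact: joined_edge.
Qed.

Lemma induced_sub G X : subgraph (induced G X) G.
Proof. by split=> [x [] | e []]. Qed.

Lemma ray_tail {G r} n : is_ray G r -> is_ray G (tail n r).
Proof.
move=> [ri rV rE]; split=> [i j /ri/addnI // | i | i]; first exact: rV.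
by rewrite /tail addnS; exact: rE.
Qed.

Lemma tail_tail m n r : tail m (tail n r) = tail n (tail m r).
Proof. by apply/funext => i; rewrite /tail addnCA. Qed.

Lemma ray_induced {G X r} : is_ray G r -> (forall i, X (r i)) ->
  is_ray (induced G X) r.
Proof.
move=> [ri rV rE] rX; split=> // i; split=> //.
by move=> y [] ->.
Qed.

Lemma rays_is_ray {G} {omega : edge_end G} {r} : rays omega r -> is_ray G r.
Proof. by have [r0 _ ->] := raysP omega => -[]. Qed.

Lemma rays_tail {G} {omega : edge_end G} {r} n :
  rays omega r -> rays omega (tail n r).
Proof.
have [r0 _ ->] := raysP omega => -[hr r0r]; split; first exact: ray_tail.
move=> F /r0r[C [hC r0C [m rC]]]; exists C; split=> //.
by exists m; rewrite tail_tail; exact: ray_tail.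
Qed.

Lemma end_of_ray {G r} : is_ray G r -> exists omega : edge_end G, rays omega r.
Proof.
move=> hr.
have ex : exists2 r', is_ray G r' &
    [set s | is_ray G s /\ edge_equivalent G r s] =
    [set s | is_ray G s /\ edge_equivalent G r' s] by exists r.
exists (EdgeEnd ex); split=> //; exact: edge_equivalent_refl.
Qed.

Lemma end_componentP {G} {omega : edge_end G} {F C r} : finite_edge_set G F ->
  component (remove_edges G F) C -> rays omega r -> has_tail_in r C ->
  end_component omega F C.
Proof.
move=> hF hC omr rC; have [D hD] := end_component_exists omega hF.
by rewrite (component_tail_inj hC hD.1 rC (hD.2 _ omr)).
Qed.

Lemma mem_basic_ends {G} {eps omega : edge_end G} {F C r} :
  finite_edge_set G F -> end_component eps F C -> rays omega r ->
  has_tail_in r C -> basic_ends eps F omega.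
Proof.
move=> hF hC omr [n rC]; exists C; split=> //.
by exists (tail n r) => //; exact: rays_tail.
Qed.

Lemma basic_ends_tail {G} {eps omega : edge_end G} {F C r} :
  finite_edge_set G F -> end_component eps F C -> basic_ends eps F omega ->
  rays omega r -> has_tail_in r C.
Proof.
move=> hF hC [D [hD [s oms sD]]] omr.
rewrite (end_component_unique hC hD).
apply: (end_componentP hF hD.1 oms _).2 => //; by exists 0.
Qed.

Lemma open_basic_ends {G} (eps : edge_end G) {F} : finite_edge_set G F ->
  open (basic_ends eps F).
Proof.
move=> hF; rewrite open_endsE => omega om; exists F => // omega' om'.
have [C hC] := end_component_exists eps hF.
have [r omr] : exists r, rays omega r by case: om => D [_ [r]]; exists r.
have rC := basic_ends_tail hF hC om omr.
have hC' := end_componentP hF hC.1 omr rC.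
have [r' omr'] : exists r, rays omega' r by case: om' => D [_ [r']]; exists r'.
exact: mem_basic_ends hF hC omr' (basic_ends_tail hF hC' om' omr').
Qed.

Lemma rays_nonempty {G} (omega : edge_end G) : exists r, rays omega r.
Proof.
by have [r hr ->] := raysP omega; exists r; split=> //; exact: edge_equivalent_refl.
Qed.

Lemma remove_edges_anti {G} (F F' : set (set T)) : F `<=` F' ->
  subgraph (remove_edges G F') (remove_edges G F).
Proof. by move=> sF; split=> // e [Ge nF]; split=> // /sF. Qed.

(** The edges separating a ray of [eps] from each of the finitely many vertices
    of [F0] are deleted together. *)
Lemma timid_separated {G} (F0 : set T) (eps : edge_end G) :
  finite_set F0 -> F0 `<=` timid G ->
  exists F C, [/\ finite_edge_set G F, end_component eps F C &
                  vertices C `<=` ~` F0].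
Proof.
move=> F0fin F0t; have [r er] := rays_nonempty eps.
have /choice[E EP] : forall v, exists E, F0 v -> finite_edge_set G E /\
    forall C, component (remove_edges G E) C -> vertices C v ->
      ~ has_tail_in r C.
  move=> v; have [F0v|] := pselect (F0 v); last by exists set0.
  have [_ /(_ _ (rays_is_ray er)) ndom] := F0t _ F0v.
  have /existsNP[E /not_implyP[Efin nE]] := ndom.
  by exists E => _; split=> // C hC Cv rC; apply: nE; exists C.
pose F := \bigcup_(v in F0) E v.
have hF : finite_edge_set G F.
  split; first by apply: bigcup_finite => // v /EP[[]].
  by move=> e [v /EP[[_ +] _]]; apply.
have [C hC] := end_component_exists eps hF; exists F, C; split=> // v Cv F0v.
have [hE nE] := EP _ F0v.
have [[sC cC _] rC] := hC.
have sub : subgraph C (remove_edges G (E v)).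
  by apply: subgraph_trans sC (remove_edges_anti _ _ _) => e; exists v.
have [D hD CD] := connected_sub_component sub cC.
by apply: (nE D hD (CD.1 _ Cv)); apply: has_tail_in_sub CD (rC _ er).
Qed.

(** A basic set whose component avoids [F0] meets the ends of one component of
    [G - F0] only, so choosing, for every component with a ray, a member of the
    subcover that contains an end of it is injective. *)
Lemma ray_components_le {G} {L} (lambda : set L) (F0 : set T) :
  subcovers_le (edge_end G) lambda -> finite_set F0 -> F0 `<=` timid G ->
  ray_components G F0 #<= lambda.
Proof.
move=> Llam F0fin F0t.
pose U := [set B : set (edge_end G) | exists eps F C,
  [/\ finite_edge_set G F, end_component eps F C, vertices C `<=` ~` F0 &
      B = basic_ends eps F]].
have [||W [WU Wcov Wlam]] := Llam U.
- by move=> _ [eps [F [C [hF _ _ ->]]]]; exact: open_basic_ends.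
- rewrite -subTset => eps _.
  have [F [C [hF hC CF0]]] := timid_separated F0 eps F0fin F0t.
  exists (basic_ends eps F); first by exists eps, F, C.
  by have [r er] := rays_nonempty eps; exact: mem_basic_ends hF hC er (hC.2 _ er).
apply: card_le_trans Wlam; apply/card_le_relP.
exists (fun D B => W B /\ exists omega r, [/\ B omega, rays omega r & is_ray D r]).
split=> [D [[sD _ _] [r Dr]]|].
  have [|omega omr] := @end_of_ray G r.
    by apply: is_ray_sub Dr; exact: subgraph_trans sD (induced_sub _ _).
  have [B WB Bo] : cover W id omega by rewrite Wcov.
  by exists B => //; split=> //; exists omega, r.
move=> D1 D2 B [hD1 _] [hD2 _] [WB [o1 [r1 [Bo1 or1 Dr1]]]].
move=> [_ [o2 [r2 [Bo2 or2 Dr2]]]].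
have [eps [F [C [hF hC CF0 BE]]]] := WU _ WB.
have sub : subgraph C (remove_vertices G F0).
  have [[[sV sE] _ _] _] := hC; split=> [x Cx | e Ce].
    by split; [exact: sV | exact: CF0].
  split; first by have [] := sE _ Ce.
  by have [x [y [Cx Cy _ ->]]] := edges_pairs Ce => z [] ->; exact: CF0.
have [D hD CD] := connected_sub_component sub (let: And3 _ c _ := hC.1 in c).
suff inD D' r omega : component (remove_vertices G F0) D' -> B omega ->
    rays omega r -> is_ray D' r -> D' = D.
  by rewrite (inD _ _ _ hD1 Bo1 or1 Dr1) (inD _ _ _ hD2 Bo2 or2 Dr2).
move=> hD' Bo omr D'r; rewrite BE in Bo.
have rC := basic_ends_tail hF hC Bo omr.
have rD' : has_tail_in r D' by exists 0.
exact: component_tail_inj hD' hD rD' (has_tail_in_sub CD rC).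
Qed.
End GraphFacts.

Lemma ray_leaves_finite {T} {G : graph T} {r} {V : set T} :
  is_ray G r -> finite_set V -> exists n, forall i, ~ V (tail n r i).
Proof.
move=> [ri _ _] Vfin.
have fin : finite_set (r @^-1` V).
  by apply: finite_preimage => // i j _ _; exact: ri.
have [s sE] := (finite_seqP _).1 fin.
exists (\max_(k <- s) k).+1 => i Vi.
have : [set` s] ((\max_(k <- s) k).+1 + i) by rewrite -sE.
move=> /= /(@leq_bigmax_seq _ s xpredT id _)/(_ isT).
by rewrite leqNgt /= ltnS leq_addr.
Qed.

Lemma path_induced {T : eqType} {G : graph T} {X : set T} {u p} :
  path (adjacent (induced G X)) u p ->
  path (adjacent G) u p /\ forall x, x \in p -> X x.
Proof.
elim: p u => [//|x p IH] u /= /andP[/asboolP[ux uxX] /IH[xp pX]].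
split; first by rewrite xp andbT; apply/asboolP.
by move=> y; rewrite inE => /predU1P[->|/pX //]; apply: uxX; right.
Qed.

(** * Edge cuts *)

(** [V] is the set of deleted vertices: for [X] disjoint from [V] this is the
    set of edges of [G - V] that leave [X]. *)
Definition cut {T} (G : graph T) (V X : set T) : set (set T) :=
  [set e | edges G e /\ exists a b, [/\ X a, ~ X b, ~ V b & e = [set a; b]]].

Definition connected_set {T} (G : graph T) (X : set T) :=
  forall u v, X u -> X v -> joined (induced G X) u v.

Lemma cut_setD {T} {G : graph T} {F C} {V X : set T} :
  component (remove_edges G F) C ->
  cut G V (X `\` vertices C) `<=` cut G V X `|` F.
Proof.
move=> hC e [Ge [a [b [[Xa nCa] nXb nVb ee]]]].
have [Xb|nX] := pselect (X b); last by left; split=> //; exists a, b.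
right; apply: contrapT => nF; apply: nCa.
have Cb : vertices C b by apply: contrapT => nCb; apply: nXb.
by apply: (component_edge_closed hC Cb); rewrite setUC -ee.
Qed.

Definition ncut {T} (G : graph T) (V X : set T) : nat :=
  #|` fset_set (cut G V X)|%fset.

Lemma ncut_sub {T} (G : graph T) (V X Y : set T) : finite_set (cut G V Y) ->
  cut G V X `<=` cut G V Y -> ncut G V X <= ncut G V Y.
Proof.
move=> Yf XY; apply: fsubset_leq_card; rewrite -fset_set_sub //.
exact: sub_finite_set XY Yf.
Qed.

Lemma cutI {T} (G : graph T) (V X Y : set T) :
  cut G V (X `&` Y) `<=` cut G V X `|` cut G V Y.
Proof.
move=> e [Ge [a [b [[Xa Ya] nXY nVb ee]]]].
have [Xb|nXb] := pselect (X b); last by left; split=> //; exists a, b.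
by right; split=> //; exists a, b; split=> // Yb; apply: nXY.
Qed.

Lemma cutU {T} (G : graph T) (V X Y : set T) :
  cut G V (X `|` Y) `<=` cut G V X `|` cut G V Y.
Proof.
move=> e [Ge [a [b [[Xa|Ya] nXY nVb ee]]]].
  by left; split=> //; exists a, b; split=> // Xb; apply: nXY; left.
by right; split=> //; exists a, b; split=> // Yb; apply: nXY; right.
Qed.

Lemma cutIU {T} (G : graph T) (V X Y : set T) :
  cut G V (X `&` Y) `&` cut G V (X `|` Y) `<=` cut G V X `&` cut G V Y.
Proof.
move=> e [[Ge [a [b [[Xa Ya] nI nVb ee]]]] [_ [c [d [_ nU nVd ee']]]]].
have ad : d <> a by move=> da; apply: nU; rewrite da; left.
have db : d = b.
  have : [set a; b] d by rewrite -ee ee'; right.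
  by case.
by rewrite db in nU; split; split=> //; exists a, b; split=> // ?; apply: nU; [left|right].
Qed.

(** Every edge is counted at least as often on the right: [cutI] and [cutU]
    place each cut edge on the left in one of the cuts on the right, and [cutIU]
    places an edge counted twice on the left in both. *)
Lemma ncut_submodular {T} (G : graph T) (V X Y : set T) :
  finite_set (cut G V X) -> finite_set (cut G V Y) ->
  ncut G V (X `&` Y) + ncut G V (X `|` Y) <= ncut G V X + ncut G V Y.
Proof.
move=> Xf Yf.
have XYf : finite_set (cut G V X `|` cut G V Y) by rewrite finite_setU.
have If := sub_finite_set (@cutI _ G V X Y) XYf.
have Uf := sub_finite_set (@cutU _ G V X Y) XYf.
rewrite /ncut -cardfsUI -[leqRHS]cardfsUI -!fset_setU // -!fset_setI //.
apply: leq_add; apply: fsubset_leq_card;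
  rewrite -fset_set_sub ?finite_setU //; try exact: finite_setIl.
  by rewrite subUset; split; [exact: cutI | exact: cutU].
exact: cutIU.
Qed.

(** * Concatenating paths to a ray *)

(** Each path stays in the layer [C n \ C n.+1], so different paths are
    disjoint. *)
Section Concatenation.
Context {T : eqType} {G : graph T}.
Variables (C : nat -> set T) (v : nat -> T) (p : nat -> seq T).
Hypothesis C0 : C 0 `<=` vertices G.
Hypothesis Canti : forall n, C n.+1 `<=` C n.
Hypothesis pC : forall n x, x \in v n :: p n -> C n x /\ ~ C n.+1 x.
Hypothesis puniq : forall n, uniq (v n :: p n).
Hypothesis ppath : forall n, path (adjacent G) (v n) (rcons (p n) (v n.+1)).

Fixpoint walk n : seq T := if n is m.+1 then walk m ++ v m :: p m else [::].

Lemma size_walk n : n <= size (walk n).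
Proof.
elim: n => //= n IH; rewrite size_cat /= addnS ltnS.
exact: leq_trans IH (leq_addr _ _).
Qed.

Lemma sorted_walk n : sorted (adjacent G) (rcons (walk n) (v n)).
Proof.
elim: n => //= n IH; rewrite rcons_cat rcons_cons sorted_cat_cons IH.
exact: ppath.
Qed.

Lemma walk_left n x : x \in walk n -> ~ C n x.
Proof.
elim: n => //= n IH; rewrite mem_cat => /orP[/IH nC /Canti // | /pC[]//].
Qed.

Lemma uniq_walk n : uniq (walk n).
Proof.
elim: n => //= n IH; rewrite cat_uniq IH puniq andbT andTb.
apply/hasPn => x /pC[Cx _]; apply/negP => /walk_left; exact.
Qed.

Lemma nth_walk x n m i : n <= m -> i < size (walk n) ->
  nth x (walk m) i = nth x (walk n) i.
Proof.
move=> /subnK <-; move: (m - n) => k; elim: k => // k IH i_n.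
rewrite addSn /= nth_cat IH // ifT //; apply: leq_trans i_n _.
by elim: k {IH} => // k IH; rewrite addSn /= size_cat; exact: leq_trans IH (leq_addr _ _).
Qed.

(** The vertex number [i] is read off the walk made of the first [i.+1] paths,
    which is long enough to contain it; [nth_walk] makes this independent of the
    walk used. *)
Lemma concatenated_ray : exists2 r, is_ray G r &
  forall n, exists2 i, n <= i & r i = v n.
Proof.
pose r i := nth (v 0) (walk i.+1) i.
have rE n i : i < n -> r i = nth (v 0) (walk n) i.
  by move=> i_n; apply/esym/nth_walk => //; exact: size_walk.
have wE n i : i < n -> i < size (walk n).
  by move=> i_n; exact: leq_trans i_n (size_walk _).
exists r; first split.
- move=> i j; pose m := (maxn i j).+1.
  have im : i < m by rewrite ltnS leq_maxl.
  have jm : j < m by rewrite ltnS leq_maxr.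
  rewrite (rE m) // (rE m) // => /eqP; rewrite nth_uniq ?uniq_walk ?wE //.
  by move=> /eqP.
- move=> i; apply: C0.
  have : r i \in walk i.+1 by apply: mem_nth; exact: wE.
  elim: i.+1 => //= n IH; rewrite mem_cat => /orP[/IH // | /pC[+ _]].
  by elim: n {IH} => // n IH /Canti.
- move=> i; have /(sortedP (v 0)) /(_ i) := sorted_walk i.+2.
  rewrite size_rcons !nth_rcons !wE // => /(_ _)/asboolP.
  by rewrite -!rE //; apply; rewrite ltnS; exact: wE.
- move=> n; exists (size (walk n)); first exact: size_walk.
  rewrite /r (@nth_walk (v 0) n.+1) /=; first by rewrite nth_cat ltnn subnn.
    by rewrite ltnS size_walk.
  by rewrite size_cat /= addnS ltnS leq_addr.
Qed.
End Concatenation.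

(** * Covered sets of vertices *)

Definition ends_in {T} (G : graph T) (X : set T) : set (edge_end G) :=
  [set omega | exists2 r, rays omega r & forall i, X (r i)].

Section OpenCover.
Context {T : eqType} {G : graph T} {K : Type} {kappa : set K}.
Context {U : set (set (edge_end G))}.
Hypothesis kinf : infinite_set kappa.
Hypothesis Uopen : U `<=` open.
Hypothesis Ucov : cover U id = setT.

Definition covered (X : set T) := exists W : set (set (edge_end G)),
  [/\ W `<=` U, W #<= kappa & ends_in G X `<=` cover W id].

Lemma covered_bigcup {I} (J : set I) (X : I -> set T) (Y : set T) :
  J #<= kappa -> (forall j, J j -> covered (X j)) ->
  ends_in G Y `<=` \bigcup_(j in J) ends_in G (X j) -> covered Y.
Proof.
move=> Jk cX sY.
have /choice[W WP] : forall j, exists W : set (set (edge_end G)), J j ->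
    [/\ W `<=` U, W #<= kappa & ends_in G (X j) `<=` cover W id].
  by move=> j; have [/cX[W]|] := pselect (J j); [exists W | exists set0].
exists (\bigcup_(j in J) W j); split.
- by move=> B [j /WP[+ _ _]]; apply.
- by apply: card_bigcup_le => // j /WP[].
- move=> omega /sY[j Jj]; have [_ _ +] := WP _ Jj => /[apply] -[B WB Bo].
  by exists B => //; exists j.
Qed.

Lemma covered_sub {X Y : set T} : Y `<=` X -> covered X -> covered Y.
Proof.
move=> YX [W [WU Wk XW]]; exists W; split=> // omega [r omr Yr].
by apply: XW; exists r => // i; exact: YX.
Qed.

Lemma covered0 : covered set0.
Proof.
exists set0; split; [exact: sub0set | exact: card_ge0 | ].
by move=> omega [r _ /(_ 0)].
Qed.

Lemma covered_two {X Y Z : set T} : covered X -> covered Y ->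
  ends_in G Z `<=` ends_in G X `|` ends_in G Y -> covered Z.
Proof.
move=> cX cY sZ.
apply: (@covered_bigcup bool setT (fun b => if b then X else Y)).
- exact: finite_card_le.
- by case.
- by move=> omega /sZ[] ?; [exists true | exists false].
Qed.

(** Ends with a ray in [X] have one in [X `&` P] for a component [P] of
    [G - V], and there are at most [kappa] such [P], so one of these sets, [Y],
    is uncovered.  If [Y] is not connected then, as [P] is, every component of
    [Y] contains one of the finitely many vertices [J] at which cut edges of [Y]
    start, so [Y] has finitely many components and one of them is uncovered. *)
Lemma uncovered_connected {V X : set T} : ray_components G V #<= kappa ->
  X `<=` vertices G `\` V -> finite_set (cut G V X) -> ~ covered X ->
  exists Q, [/\ Q `<=` X, ~ covered Q, connected_set G Q &
                cut G V Q `<=` cut G V X].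
Proof.
move=> Vk XV cutX nX.
have [P hP nXP] : exists2 P, component (remove_vertices G V) P &
    ~ covered (X `&` vertices P).
  apply: contrapT => /forall2NP noP; apply: nX.
  apply: (@covered_bigcup _ (ray_components G V)
           (fun P => X `&` vertices P)) => //.
    by move=> P [hP _]; apply: contrapT; case: (noP P).
  move=> omega [r omr Xr].
  have Vr : is_ray (remove_vertices G V) r.
    apply: ray_induced (rays_is_ray omr) _ => i; exact: (XV _ (Xr i)).2.
  have rP := ray_component Vr.
  exists (component_of (remove_vertices G V) (r 0)).
    by split; [apply: component_ofP; case: Vr | exists r].
  by exists r => // i; split=> //; case: rP.
pose Y := X `&` vertices P.
have closedY a b : Y a -> ~ Y b -> ~ V b -> edges G [set a; b] -> ~ X b.
  move=> [Xa Pa] nYb nVb ab Xb; apply: nYb; split=> //.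
  apply: (component_edge_closed hP Pa); split=> // y [] ->//.
  exact: (XV _ Xa).2.
have cutY : cut G V Y `<=` cut G V X.
  move=> e [Ge [a [b [Ya nYb nVb ee]]]]; split=> //; exists a, b; split=> //.
    by case: Ya.
  by rewrite ee in Ge; exact: closedY nVb Ge.
pose J := [set a | Y a /\ exists b, [/\ ~ Y b, ~ V b & edges G [set a; b]]].
have Jfin : finite_set J.
  apply: (@sub_finite_set _ _ (\bigcup_(e in cut G V Y) e)).
    move=> a [Ya [b [nYb nVb ab]]]; exists [set a; b]; last by left.
    by split=> //; exists a, b.
  apply: bigcup_finite; first exact: sub_finite_set cutX.
  by move=> e [_ [a [b [_ _ _ ->]]]]; exact: finite_set2.
have [[u Yu uJ]|allJ] := pselect (exists2 u, Y u &
    forall a, J a -> ~ joined (induced G Y) u a).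
  exists Y; split=> //; first by move=> x [].
  suff ju w : Y w -> joined (induced G Y) u w.
    by move=> x y /ju ux /ju; exact: (joined_trans (joined_sym ux)).
  move=> Yw; apply: contrapT => nuw.
  have [_ [_ cP] _] := hP; have [sP _ _] := hP.
  have juw := joined_sub sP (cP _ _ Yu.2 Yw.2).
  have uu : (Y `&` joined (induced G Y) u) u by split=> //; exact: joined_refl.
  have uw : ~ (Y `&` joined (induced G Y) u) w by case.
  have [a [b [[Ya ua] nXb [ab sab] _]]] := crossing_edge juw uu uw.
  have nVb : ~ V b by apply: sab; right.
  have nYb : ~ Y b.
    move=> Yb; apply: nXb; split=> //; apply: joined_trans ua (joined_edge _).
    by split=> // y [] ->.
  by apply: (uJ a) ua; split=> //; exists b.
pose Q a := Y `&` joined (induced G Y) a.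
have [a [Ya _] nQ] : exists2 a, J a & ~ covered (Q a).
  apply: contrapT => /forall2NP noQ; apply: nXP.
  apply: (@covered_bigcup _ J Q); first exact: finite_card_le.
    by move=> a Ja; apply: contrapT; case: (noQ a).
  move=> omega [r omr Yr].
  have [a Ja ja] : exists2 a, J a & joined (induced G Y) (r 0) a.
    apply: contrapT => /forall2NP na; apply: allJ.
    exists (r 0) => [|a Ja ja]; first exact: Yr.
    by case: (na a).
  exists a => //; exists r => // i; split; first exact: Yr.
  apply: joined_trans (joined_sym ja) _.
  have := ray_component (ray_induced (rays_is_ray omr) Yr).
  by case=> _ /(_ i)[].
exists (Q a); split=> //; first by move=> x [[]].
  have sub : subgraph (component_of (induced G Y) a) (induced G (Q a)).
    split=> [x [[Gx Yx] ax] | e [[Ge eY] ea]]; first by [].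
    by split=> // x ex; split; [exact: eY | exact: ea].
  move=> x y [Yx ax] [Yy ay]; apply: joined_sub sub _.
  exact: joined_trans (joined_sym (component_of_joined ax)) (component_of_joined ay).
move=> e [Ge [x [b [[Yx ax] nQb nVb ee]]]]; apply: cutY; split=> //.
exists x, b; split=> // Yb; apply: nQb; split=> //.
apply: joined_trans ax (joined_edge _); split; first by rewrite -ee.
by move=> y [] ->.
Qed.

Lemma covered_nbhs (eps : edge_end G) : exists F C,
  [/\ finite_edge_set G F, end_component eps F C & covered (vertices C)].
Proof.
have [B UB Be] : cover U id eps by rewrite Ucov.
have := Uopen _ UB; rewrite open_endsE => /(_ _ Be)[F hF sB].
have [C hC] := end_component_exists eps hF; exists F, C; split=> //.
exists [set B]; split; first by move=> _ ->.
  by apply: finite_card_le => //; exact: finite_set1.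
move=> omega [r omr Cr]; exists B => //; apply: sB.
have [n Fr] := ray_remove_edges (rays_is_ray omr) hF.1.
apply: (mem_basic_ends hF hC (rays_tail n omr)); exists 0.
have := ray_component Fr; rewrite -(component_eq hC.1) //.
exact: Cr.
Qed.

(** As [F] is finite, a ray in [X] has a tail inside [C] or a tail outside
    [C]. *)
Lemma uncovered_setD {F C} {X : set T} : finite_edge_set G F ->
  component (remove_edges G F) C -> covered (vertices C) -> ~ covered X ->
  ~ covered (X `\` vertices C).
Proof.
move=> hF hC cC nX cD; apply: nX; apply: (covered_two cC cD).
move=> omega [r omr Xr].
have [D hD [n rD]] := ray_tail_component (rays_is_ray omr) hF.1.
have [e|DC] := pselect (D = C).
  left; exists (tail n r); first exact: rays_tail.
  by rewrite -e; case: rD.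
right; exists (tail n r); first exact: rays_tail.
move=> i; split; first exact: Xr.
move=> Ci; apply: DC; apply: component_inj hD hC _ Ci.
by case: rD.
Qed.

(** * A decreasing sequence of uncovered regions *)

Hypothesis kcomp : forall F : set T, finite_set F -> F `<=` timid G ->
  ray_components G F #<= kappa.

(** The stage [(V n, C n, v n)] of the construction. *)
Record state := State { removed : set T; region : set T; pivot : T }.
Implicit Types (s t : state).

Set Implicit Arguments.
Record valid s : Prop := Valid {
  removed_finite : finite_set (removed s);
  removed_timid : removed s `<=` timid G;
  region_vertices : region s `<=` vertices G `\` removed s;
  region_cut : finite_set (cut G (removed s) (region s));
  region_uncovered : ~ covered (region s);
  region_connected : connected_set G (region s);
  pivot_region : region s (pivot s)
}.

(** The possible regions of a next stage with the same removed set. *)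
Definition candidate s (X : set T) :=
  [/\ X `<=` region s, ~ covered X, ~ X (pivot s) &
      finite_set (cut G (removed s) X)].

(** [p] continues the pivot of [s] to a path that enters the region of [t] at the
    pivot of [t].  Steps made without a candidate occur only finitely often,
    so for them it suffices that the region shrinks. *)
Record step s t (p : seq T) : Prop := Step {
  step_region : region t `<=` region s;
  step_path_region : forall x, x \in pivot s :: p -> region s x /\ ~ region t x;
  step_uniq : uniq (pivot s :: p);
  step_path : path (adjacent G) (pivot s) (rcons p (pivot t));
  step_cut : (exists X, candidate s X) ->
    [/\ removed t = removed s, candidate s (region t) & forall X, candidate s X ->
      ncut G (removed s) (region t) <= ncut G (removed s) X]
}.

Unset Implicit Arguments.

(** A path in [X] from [v] to [Y], cut off at its first vertex in [Y]. *)
Lemma path_to_region {X Y : set T} {v : T} : connected_set G X -> X v ->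
  Y `<=` X -> ~ Y v -> Y !=set0 -> exists p w, [/\ Y w,
    forall x, x \in v :: p -> X x /\ ~ Y x, uniq (v :: p) &
    path (adjacent G) v (rcons p w)].
Proof.
move=> cX Xv YX nYv [y Yy].
have [a [b [Ya nYb [ab abX] [q qp qa]]]] :=
  crossing_edge (cX _ _ Xv (YX _ Yy)) (X := ~` Y) nYv (fun n => n Yy).
move: qa; case/shortenP: qp => p pp up _ pa.
have [pp' pY] := path_induced pp; have [pG pX] := path_induced pp'.
exists p, b; split=> //; first by apply: contrapT.
  by move=> x; rewrite inE => /predU1P[-> //|xp]; split; [exact: pX | exact: pY].
by rewrite rcons_path pG pa; apply/asboolP.
Qed.

(** If the pivot edge-dominated a ray, it would lie in every component
    neighbourhood of the end of that ray, and removing a covered one from the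
    region would leave a candidate. *)
Lemma no_candidate_timid s : valid s -> ~ (exists X, candidate s X) ->
  timid G (pivot s).
Proof.
move=> vs nX; have Cv := pivot_region vs.
split; first by have [] := region_vertices vs _ Cv.
move=> r hr dom; have [omega omr] := end_of_ray hr.
have [F [C [hF hC cC]]] := covered_nbhs omega.
have [D [hD Dv rD]] := dom _ hF.
have e := component_tail_inj hC.1 hD (hC.2 _ omr) rD.
apply: nX; exists (region s `\` vertices C); split.
- exact: subDsetl.
- exact: uncovered_setD hF hC.1 cC (region_uncovered vs).
- by rewrite e => -[].
- apply: sub_finite_set (cut_setD hC.1) _; rewrite finite_setU.
  by split; [exact: region_cut vs | case: hF].
Qed.

Lemma uncovered_setD1 {X : set T} v : ~ covered X -> ~ covered (X `\ v).
Proof.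
move=> nX cX; apply: nX; apply: (covered_two cX cX) => omega [r omr Xr].
have [n nr] := ray_leaves_finite (rays_is_ray omr) (finite_set1 v).
left; exists (tail n r); first exact: rays_tail.
by move=> i; split; [exact: Xr | exact: nr].
Qed.

Lemma uncovered_nonempty {X : set T} : ~ covered X -> X !=set0.
Proof.
move=> nX; apply/set0P/negP => /eqP X0; apply: nX; rewrite X0; exact: covered0.
Qed.

Lemma step_exists s : valid s -> exists t p, valid t /\ step s t p.
Proof.
move=> vs; have [Vf Vt CV Cf nC cC Cv] := vs.
have [[X0 cX0]|ncand] := pselect (exists X, candidate s X).
  pose P n := `[< exists2 X, candidate s X & ncut G (removed s) X = n >].
  have exP : exists n, P n by exists (ncut G (removed s) X0); apply/asboolP; exists X0.
  case: (ex_minnP exP) => n /asboolP[X [XC nX nXv Xf] Xn] nmin.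
  have [|Q [QX nQ cQ cutQ]] :=
    uncovered_connected (kcomp _ Vf Vt) _ Xf nX.
    by move=> x /XC/CV.
  have QC := subset_trans QX XC.
  have nQv : ~ Q (pivot s) by move=> /QX.
  have Qf := sub_finite_set cutQ Xf.
  have [p [w [Qw pQ pu pp]]] :=
    path_to_region cC Cv QC nQv (uncovered_nonempty nQ).
  exists (State (removed s) Q w), p; split; first by split=> // x /QC/CV.
  split=> // _; split=> [//||Y cY]; first by split.
  apply: leq_trans (ncut_sub _ _ _ _ Xf cutQ) _.
  by rewrite Xn; apply: nmin; apply/asboolP; exists Y.
pose V' := pivot s |` removed s.
have Vf' : finite_set V' by rewrite finite_setU; split=> //; exact: finite_set1.
have Vt' : V' `<=` timid G.
  by rewrite subUset; split=> // _ ->; exact: no_candidate_timid.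
have cutD : cut G V' (region s `\ pivot s) `<=` cut G (removed s) (region s).
  move=> e [Ge [a [b [[Ca _] nDb nVb ee]]]]; split=> //; exists a, b; split=> //.
    by move=> Cb; apply: nDb; split=> // bv; apply: nVb; left.
  by move=> Vb; apply: nVb; right.
have Df := sub_finite_set cutD Cf.
have [|Q [QX nQ cQ cutQ]] :=
  uncovered_connected (kcomp _ Vf' Vt') _ Df (uncovered_setD1 _ nC).
  by move=> x [Cx xv]; have [Gx nVx] := CV _ Cx; split=> // -[].
have QC : Q `<=` region s by move=> x /QX[].
have nQv : ~ Q (pivot s) by move=> /QX[_]; apply.
have [p [w [Qw pQ pu pp]]] :=
  path_to_region cC Cv QC nQv (uncovered_nonempty nQ).
exists (State V' Q w), p; split; last by split.
split=> //=; last exact: sub_finite_set cutQ Df.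
move=> x /QX[Cx xv]; have [Gx nVx] := CV _ Cx; split=> // -[] //.
Qed.

(** The sets [X n := C n \ A] bound the cuts of the regions from above, and the
    cut [E] of the intersection of the regions bounds them from below: each
    edge of [E] is a cut edge of all late enough regions, so [E] is finite and
    contained in the cuts of late regions.  Then no edge inside a late region can
    leave the intersection, although the region is connected and has its pivot
    outside the intersection. *)
Lemma sequence_absurd (st : nat -> state) (p : nat -> seq T) :
  (forall n, valid (st n)) -> (forall n, step (st n) (st n.+1) (p n)) -> False.
Proof.
move=> vst sst.
pose V n := removed (st n); pose C n := region (st n); pose v n := pivot (st n).
have Cstep n : C n.+1 `<=` C n := step_region (sst n).
have Canti n m : n <= m -> C m `<=` C n.
  by move=> /subnK <-; elim: (m - n) => // k IH x /Cstep/IH.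
have vC n : C n (v n) := pivot_region (vst n).
have nvC n : ~ C n.+1 (v n).
  by have [] := step_path_region (sst n) (v n) (mem_head _ _).
have [r hr rv] : exists2 r, is_ray G r &
    forall n, exists2 i, n <= i & r i = v n.
  apply: (concatenated_ray C v p) => // n.
  - by move=> /(region_vertices (vst 0))[].
  - exact: step_path_region (sst n).
  - exact: step_uniq (sst n).
  - exact: step_path (sst n).
have [omega omr] := end_of_ray hr.
have [F [D [hF [hD rD] cD]]] := covered_nbhs omega.
pose A := vertices D.
have [N NA] : exists N, forall n, N <= n -> A (v n).
  have [N [_ NA _]] := rD _ omr; exists N => n Nn.
  by have [i ni <-] := rv n; have := NA (i - N); rewrite /tail subnKC //; exact: leq_trans ni.
pose X n := C n `\` A.
have nX n : ~ covered (X n) := uncovered_setD hF hD cD (region_uncovered (vst n)).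
have Xf n : finite_set (cut G (V n) (X n)).
  apply: sub_finite_set (cut_setD hD) _; rewrite finite_setU.
  by split; [exact: region_cut (vst n) | case: hF].
have candX n : N <= n -> candidate (st n) (X n).
  move=> Nn; split; [exact: subDsetl | exact: nX | | exact: Xf].
  by move=> [_]; apply; exact: NA.
have stepX n : N <= n -> [/\ V n.+1 = V n, candidate (st n) (C n.+1) &
    forall Y, candidate (st n) Y -> ncut G (V n) (C n.+1) <= ncut G (V n) Y].
  by move=> Nn; apply: step_cut (sst n) _; exists (X n); exact: candX.
have VN n : N <= n -> V n = V N.
  move=> /subnK <-; elim: (n - N) => // k IH; rewrite addSn -IH.
  by have [] := stepX _ (leq_addl k N).
have Xle n : N <= n -> ncut G (V N) (X n) <= ncut G (V N) (X N).
  move=> /subnK <-; elim: (n - N) => // k IH; rewrite addSn.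
  apply: leq_trans IH; have := leq_addl k N; move: (k + N) => m Nm.
  have [_ [_ _ _ Cf] Cmin] := stepX _ Nm.
  have Xm := Xf m.
  have -> : X m.+1 = X m `&` C m.+1.
    apply/seteqP; split=> x; first by move=> [Cx nAx]; split=> //; split=> //; exact: Cstep.
    by move=> [[_ nAx] Cx].
  (* The union is no better than the minimal candidate [C m.+1], so by
     submodularity the intersection is no worse than [X m]. *)
  have cU : candidate (st m) (X m `|` C m.+1).
    split.
    - by rewrite subUset; split; [exact: subDsetl | exact: Cstep].
    - by move=> /(covered_sub (@subsetUl _ _ _)); exact: nX.
    - by move=> [[_ /(_ (NA _ Nm))] | /nvC].
    - by apply: sub_finite_set (cutU _ _ _ _) _; rewrite finite_setU.
  have := ncut_submodular _ _ _ _ Xm Cf; have := Cmin _ cU.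
  rewrite -/(V m) (VN _ Nm) => le1 le2.
  by rewrite -(leq_add2r (ncut G (V N) (C m.+1))) (leq_trans _ le2) // leq_add2l.
have Cle n : N < n -> ncut G (V N) (C n) <= ncut G (V N) (X N).
  case: n => // n Nn; apply: leq_trans (Xle _ Nn).
  by have [_ _ /(_ _ (candX _ Nn))] := stepX _ Nn; rewrite (VN _ Nn).
pose Cinf := [set x | forall n, C n x].
(* The region [C n] is connected and meets both [A] and its complement, so it
   contains an edge of the finite set [F]; one edge serves for all [n]. *)
have [x Cx] : Cinf !=set0.
  have [e Fe eC] : exists2 e, F e & forall n, N <= n -> e `<=` C n.
    apply: contrapT => /forall2NP noe.
    have [|M MP] := finite_eventually F (fun e n => ~ e `<=` C n) hF.1.
      move=> e Fe; have [//|/existsNP[n /not_implyP[Nn neC]]] := noe e.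
      by exists n => m nm eC; apply: neC => y /eC; exact: Canti.
    pose n := maxn M N.
    have [w [Cw nAw]] := uncovered_nonempty (nX n).
    have Av : A (v n) by apply: NA; exact: leq_maxr.
    have [a [b [Aa nAb [ab abC] _]]] :=
      crossing_edge (region_connected (vst n) _ _ (vC n) Cw) Av nAw.
    have Fab : F [set a; b].
      apply: contrapT => nF; apply: nAb.
      by apply: (component_edge_closed hD Aa).
    exact: MP Fab n (leq_maxl _ _) abC.
  have [u [w [_ _ _ ee]]] := edges_pairs (hF.2 _ Fe).
  exists u => n; apply: (Canti _ _ (leq_maxl n N)).
  by apply: eC (leq_maxr _ _) _ _; rewrite ee; left.
pose E := cut G (V N) Cinf.
have Ecut B : finite_set B -> B `<=` E -> exists2 M, N < M &
    forall e, B e -> cut G (V N) (C M) e.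
  move=> Bf BE; have [|M MP] :=
      finite_eventually B (fun e n => cut G (V N) (C n) e) Bf.
    move=> e /BE[Ge [a [b [Ca nCb nVb ee]]]].
    have /existsNP[n nCn] := nCb.
    exists n => m nm; split=> //; exists a, b; split=> //.
    by move=> /(Canti _ _ nm).
  exists (maxn M N.+1); first by rewrite leq_max ltnSn orbT.
  by move=> e Be; apply: MP => //; exact: leq_maxl.
have [Efin|Einf] := pselect (finite_set E).
  have [M NM cutM] := Ecut E Efin (fun _ => id).
  have nCv : ~ Cinf (v M) by move=> /(_ M.+1); exact: nvC.
  have [a [b [Ca nCb [ab abC] _]]] :=
    crossing_edge (region_connected (vst M) _ _ (Cx M) (vC M)) Cx nCv.
  have Cb : C M b by apply: abC; right.
  have nVb : ~ V N b.
    by rewrite -(VN M (ltnW NM)); have [] := region_vertices (vst M) _ Cb.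
  have [_ [a' [b' [_ nCb' _ ee]]]] : cut G (V N) (C M) [set a; b].
    by apply: cutM; split=> //; exists a, b.
  by apply: nCb'; apply: abC; rewrite ee; right.
have [B BE cardB] := infinite_set_fset (ncut G (V N) (X N)).+1 Einf.
have [M NM cutM] := Ecut _ (finite_fset B) BE.
have Mf : finite_set (cut G (V N) (C M)).
  by rewrite -(VN M (ltnW NM)); exact: region_cut (vst M).
have BM : #|` B|%fset <= ncut G (V N) (C M).
  rewrite -(set_fsetK B); apply: fsubset_leq_card.
  by rewrite -(fset_set_sub (finite_fset B) Mf).
by have := leq_trans cardB (leq_trans BM (Cle _ NM)); rewrite ltnn.
Qed.

Lemma covered_vertices : covered (vertices G).
Proof.
apply: contrapT => nG.
have cutG : cut G set0 (vertices G) `<=` set0.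
  move=> e [Ge [a [b [_ nGb _ ee]]]]; rewrite ee in Ge.
  by apply: nGb; have [] := edge_vertices Ge.
have [|||Q [QG nQ cQ cutQ]] := uncovered_connected (V := set0) _ _ _ nG.
- by apply: kcomp => //; exact: sub0set.
- by rewrite setD0.
- exact: sub_finite_set cutG _.
have [v Qv] := uncovered_nonempty nQ.
have v0 : valid (State set0 Q v).
  split=> //=; first by rewrite setD0.
  exact: sub_finite_set (subset_trans cutQ cutG) _.
have /choice[f fP] : forall s, exists tp : state * seq T,
    valid s -> valid tp.1 /\ step s tp.1 tp.2.
  move=> s; have [vs|nvs] := pselect (valid s); last by exists (s, [::]).
  by have [t [p tp]] := step_exists s vs; exists (t, p).
pose st n := iter n (fun s => (f s).1) (State set0 Q v).
have vst n : valid (st n) by elim: n => //= n IH; case: (fP _ IH).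
by apply: (sequence_absurd st (fun n => (f (st n)).2)) => // n; case: (fP _ (vst n)).
Qed.
End OpenCover.

(** * The Lindelof degree of the edge-end space *)

Lemma subcovers_le_ray_components {T : Type} {G : graph T} {K : Type}
    (kappa : set K) : infinite_set kappa ->
  (forall F : set T, finite_set F -> F `<=` timid G ->
    ray_components G F #<= kappa) ->
  subcovers_le (edge_end G) kappa.
Proof.
move: T G; elim/Peq => T G kinf kcomp U Uopen Ucov.
have [W [WU Wk cW]] := covered_vertices kinf Uopen Ucov kcomp.
exists W; split=> //; rewrite -subTset => omega _; apply: cW.
have [r omr] := rays_nonempty omega; exists r => //.
by have [] := rays_is_ray omr.
Qed.

Theorem corollary7p10 (T : Type) (G : graph T) (K : Type) (kappa : set K)
    (kappa_infinite : infinite_set kappa) :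
  lindelof_degree_le (edge_end G) kappa <->
  forall F : set T, finite_set F -> F `<=` timid G ->
    ray_components G F #<= kappa.
Proof.
rewrite lindelof_degree_leP //; split=> [sk F Ff Ft | kcomp].
  exact: ray_components_le.
exact: subcovers_le_ray_components.
Qed.
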